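(* Let $(G_1,d_{G_1})$ and $(G_2,d_{G_2})$ be metric graphs and let $d_{PD}^r(G_1,G_2)$ denote the local persistence distortion distance at radius $r$. If $r\le r'$, then $$d_{PD}^r(G_1,G_2)\le d_{PD}^{r'}(G_1,G_2).$$
   Context: Metric graph. $G$ is a finite connected graph with a (positive) length function on its edges; the metric $d_G$ on the geometric realization $|G|$ assigns to two points (not necessarily vertices) the minimum length of a path between them. For a base point $v\in|G|$, the geodesic distance function is $f_v:|G|\to\mathbb{R}$, $f_v(x)=d_G(v,x)$. LZZ diagram. $\mathrm{Dg}\,f_v$ denotes the $0$-dimensional level set zigzag (LZZ) persistence diagram of $f=f_v$ on $\mathbb{X}=|G|$, defined as follows. The function $f$ is of Morse type: there are finitely many critical values $a_1<\dots<a_n$ such that over each open interval $J$ among $(-\infty,a_1),(a_1,a_2),\dots,(a_n,\infty)$, $f^{-1}(J)$ is homeomorphic to $Z\times J$ for some compact and locally connected space $Z$, with $f$ corresponding to the projection onto $J$; these homeomorphisms extend to continuous functions on $Z\times\bar J$; and all level sets have finitely generated homology. Choose $-\infty<s_0<a_1<s_1<\dots<a_n<s_n<\infty$ and write $\mathbb{X}_a^b=f^{-1}([a,b])$. Apply $\mathsf{H}_0(\cdot\,;\mathbb{K})$, $\mathbb{K}$ a field, to $$\mathbb{X}_{s_0}^{s_0}\to\mathbb{X}_{s_0}^{s_1}\leftarrow\mathbb{X}_{s_1}^{s_1}\to\cdots\to\mathbb{X}_{s_{n-1}}^{s_n}\leftarrow\mathbb{X}_{s_n}^{s_n}$$ (all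 maps inclusions) and decompose into interval modules. Each interval is recorded as a point $(b,d)$: with $a_0=-\infty$ and $a_{n+1}=+\infty$, an interval whose first nonzero position is $\mathbb{X}_{s_{i-1}}^{s_i}$ (left-closed) or $\mathbb{X}_{s_i}^{s_i}$ (left-open) has $b=a_i$; one whose last nonzero position is $\mathbb{X}_{s_{j-1}}^{s_j}$ has $d=a_j$, and one whose last nonzero position is $\mathbb{X}_{s_j}^{s_j}$ has $d=a_{j+1}$. $\mathrm{Dg}\,f_v$ is the multiset of these points together with countably many copies of every diagonal point $(x,x)$. Equivalently, $\mathrm{Dg}\,f_v$ is the union of the $0$- and $1$-dimensional extended persistence diagrams of $f_v$; correspondingly each point carries a dimension, $0$ (left-closed intervals) or $1$ (left-open intervals). Bottleneck distance. $d_B(D,D')=\inf_\mu\sup_x\|x-\mu(x)\|_\infty$, over bijections $\mu:D\to D'$ of multisets (each dimension having its own countably many copies of the diagonal points), where only points of the same dimension are matched. Restriction. For $I=[r_1,r_2]$, the restriction $D^I$ of a diagram $D$ is its multiset image (multiplicities and dimensions retained) under the map $\Pi$ given by (A) $\Pi(b,d)=(b,d)$ if $r_1\le b\le d\le r_2$; (B) $\Pi(b,d)=(b,r_2)$ if $r_1\le b\le r_2\le d$; (C) $\Pi(b,d)=(r_1,d)$ if $b\le r_1\le d\le r_2$; (D) $\Pi(b,d)=(r_1,r_2)$ if $b\le r_1\le r_2\le d$; (E) $\Pi(b,d)=(b,b)$ if $r_2\le b$; (F) $\Pi(b,d)=(d,d)$ if $d\le r_1$. Persistence distortion. With $\Phi(v)=\mathrm{Dg}\,f_v$,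 the persistence distortion distance is $d_{PD}(G_1,G_2)=d_H(\Phi(|G_1|),\Phi(|G_2|))$, where $d_H$ is the Hausdorff distance with respect to $d_B$. The local version $d_{PD}^r$ ($r\ge 0$) is obtained by considering, for each base point $v$, the distance function only on points within intrinsic radius $r$ of $v$; that is, replacing $\Phi$ by $\Phi^r(v)=(\mathrm{Dg}\,f_v)^{[0,r]}$: $$d_{PD}^r(G_1,G_2)=\max\Big\{\sup_{D_1\in\Phi^r(|G_1|)}\inf_{D_2\in\Phi^r(|G_2|)}d_B(D_1,D_2),\ \sup_{D_2\in\Phi^r(|G_2|)}\inf_{D_1\in\Phi^r(|G_1|)}d_B(D_1,D_2)\Big\}.$$ *)

(* Defs.v *)
From HB Require Import structures.
From mathcomp Require Import all_boot all_order all_algebra.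
From mathcomp Require Import all_classical all_reals all_analysis.
From mathcomp Require Import lra freeg ring_quotient.

Set Implicit Arguments.
Unset Strict Implicit.
Unset Printing Implicit Defensive.

Import Order.TTheory GRing.Theory Num.Theory.
Import numFieldNormedType.Exports.

Local Open Scope classical_set_scope.
Local Open Scope ring_scope.

(* Loops and parallel edges are allowed.  The orientation given by [src] and
   [tgt] only serves to parameterize the edges. *)
Record metric_graph (R : realType) := MetricGraph {
  vertex : finType;
  edge : finType;
  src : edge -> vertex;
  tgt : edge -> vertex;
  len : edge -> R;
  len_gt0 : forall e, 0 < len e;
  vertex_gt0 : (0 < #|vertex|)%N;
  graph_connected : forall u v : vertex,
    connect (fun u v => [exists e, [|| (src e == u) && (tgt e == v)
                                     | (src e == v) && (tgt e == u)]]) u v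
}.

(* The geometric realization |G|: the vertices, and the interior points (e, t)
   of the edges, 0 < t < len e. *)
Definition geom (R : realType) (G : metric_graph R) : Type :=
  (vertex G + {p : edge G * R | 0 < p.2 < len p.1})%type.

HB.instance Definition _ (R : realType) (G : metric_graph R) :=
  Choice.copy (geom G)
    (vertex G + {p : edge G * R | (0 < p.2 < len p.1)%R})%type.

Section GeomMetric.
Context {R : realType} {G : metric_graph R}.
Implicit Types (x y z : geom G) (e : edge G).

(* The point of the closed edge [e] at parameter [s], for 0 <= s <= len e. *)
Definition epoint e (s : R) : geom G :=
  if insub (e, s) is Some p then inr p
  else inl (if s <= 0 then src e else tgt e).

(* A path is a concatenation of finitely many segments of closed edges, so the
   infimum of the lengths below is attained. *)
Inductive path_of_length : geom G -> geom G -> R -> Prop :=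
| path_nil x : path_of_length x x 0
| path_cons e s t y l : 0 <= s <= len e -> 0 <= t <= len e ->
    path_of_length (epoint e t) y l ->
    path_of_length (epoint e s) y (`|s - t| + l).

Definition geodesic_dist x y : R := inf [set l | path_of_length x y l].

Lemma epoint0 e : epoint e 0 = inl (src e).
Proof. by rewrite /epoint insubF ?lexx//= ltxx. Qed.

Lemma epoint_len e : epoint e (len e) = inl (tgt e).
Proof.
by rewrite /epoint insubF ?ltxx ?andbF//= leNgt len_gt0.
Qed.

Lemma epoint_val (p : {p : edge G * R | 0 < p.2 < len p.1}) :
  epoint (val p).1 (val p).2 = inr p.
Proof. by rewrite /epoint -surjective_pairing valK. Qed.

Lemma epointP e s : 0 <= s <= len e ->
  [\/ s = 0 /\ epoint e s = inl (src e),
      s = len e /\ epoint e s = inl (tgt e) |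
      exists2 p : {p : edge G * R | 0 < p.2 < len p.1},
        val p = (e, s) & epoint e s = inr p].
Proof.
move=> /andP[s0 sl]; case: (ltgtP 0 s) s0 => // [s0 _|<- _]; last first.
  by apply: Or31; rewrite epoint0.
case: (ltgtP s (len e)) sl => // [sl _|-> _]; last first.
  by apply: Or32; rewrite epoint_len.
apply: Or33.
have sP : 0 < (e, s).2 < len (e, s).1 by rewrite /= s0.
by exists (exist _ (e, s) sP); rewrite /epoint ?insubT.
Qed.

Lemma path_ge0 x y l : path_of_length x y l -> 0 <= l.
Proof. by elim=> // e s t {}y {}l _ _ _ l0; rewrite addr_ge0. Qed.

Lemma path_cat x y z l l' : path_of_length x y l -> path_of_length y z l' ->
  path_of_length x z (l + l').
Proof.
elim=> [{}x|e s t {}y {}l hs ht _ IH] yz; first by rewrite add0r.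
by rewrite -addrA; apply: path_cons => //; exact: IH.
Qed.

Lemma path_seg e s t : 0 <= s <= len e -> 0 <= t <= len e ->
  path_of_length (epoint e s) (epoint e t) `|s - t|.
Proof.
by move=> hs ht; rewrite -[`|_|]addr0; apply: path_cons => //; exact: path_nil.
Qed.

Lemma path_rev x y l : path_of_length x y l -> path_of_length y x l.
Proof.
elim=> [{}x|e s t {}y {}l hs ht _ IH]; first exact: path_nil.
rewrite addrC; apply: path_cat IH _; rewrite distrC; exact: path_seg.
Qed.

Lemma path_exists x y : exists l, path_of_length x y l.
Proof.
have len0 e : 0 <= 0 <= len e by rewrite lexx ltW ?len_gt0.
have len1 e : 0 <= len e <= len e by rewrite lexx ltW ?len_gt0.
have tov z : exists v l, path_of_length z (inl v) l.
  case: z => [v|p]; first by exists v, 0; exact: path_nil.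
  exists (src (val p).1); eexists; rewrite -epoint_val -epoint0.
  by apply: path_seg => //; have /andP[? ?] := valP p; rewrite !ltW.
have vtov u v : exists l, path_of_length (inl u) (inl v) l.
  have /connectP[p + ->] := graph_connected u v.
  elim: p u => [u _|w p IH u /= /andP[/existsP[e uw] /IH[l wl]]].
    by exists 0; exact: path_nil.
  suff [l' uwl] : exists l, path_of_length (inl u) (inl w) l.
    by exists (l' + l); exact: path_cat wl.
  case/orP: uw => /andP[/eqP <- /eqP <-]; eexists.
    by rewrite -epoint0 -epoint_len; exact: path_seg.
  by rewrite -epoint0 -epoint_len; exact: path_seg.
have [u [lu xu]] := tov x; have [v [lv yv]] := tov y.
have [l uv] := vtov u v.
exists (lu + (l + lv)); apply: path_cat xu (path_cat uv _); exact: path_rev.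
Qed.

Let has_inf_path x y : has_inf [set l | path_of_length x y l].
Proof.
split; first exact: path_exists.
by exists 0 => l /path_ge0.
Qed.

Lemma geodesic_dist_le x y l : path_of_length x y l -> geodesic_dist x y <= l.
Proof. by move=> xy; apply: ge_inf => //; have [] := has_inf_path x y. Qed.

Lemma le_geodesic_dist x y m :
  (forall l, path_of_length x y l -> m <= l) -> m <= geodesic_dist x y.
Proof. by move=> xy; apply: lb_le_inf => //; have [] := has_inf_path x y. Qed.

Lemma geodesic_distxx x : geodesic_dist x x = 0.
Proof.
apply/eqP; rewrite eq_le geodesic_dist_le /=; last exact: path_nil.
by apply: le_geodesic_dist => l /path_ge0.
Qed.

Lemma geodesic_dist_sym x y : geodesic_dist x y = geodesic_dist y x.
Proof. by congr inf; apply/seteqP; split=> l /=; exact: path_rev. Qed.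

Lemma geodesic_dist_triangle y x z :
  geodesic_dist x z <= geodesic_dist x y + geodesic_dist y z.
Proof.
rewrite -lerBlDr; apply: le_geodesic_dist => l xy.
rewrite lerBlDr -lerBlDl; apply: le_geodesic_dist => l' yz.
by rewrite lerBlDl; apply: geodesic_dist_le; exact: path_cat xy yz.
Qed.

(* Functions on |G| that are 1-Lipschitz along the edges separate points. *)
Let edge_lipschitz (phi : geom G -> R) := forall e s t,
  0 <= s <= len e -> 0 <= t <= len e ->
  `|phi (epoint e s) - phi (epoint e t)| <= `|s - t|.

Let edge_lipschitz_dist phi x y : edge_lipschitz phi ->
  phi x - phi y <= geodesic_dist x y.
Proof.
move=> lip; apply: le_geodesic_dist => l; elim=> [{}x|e s t {}y {}l hs ht _ IH].
  by rewrite subrr.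
rewrite -(subrKA (phi (epoint e t))); apply: lerD => //.
exact: le_trans (ler_norm _) (lip _ _ _ hs ht).
Qed.

Let interior_sep (p : {p : edge G * R | 0 < p.2 < len p.1}) y :
  geodesic_dist y (inr p) = 0 -> y = inr p.
Proof.
move: p => p d0; pose e0 := (val p).1; pose t0 := (val p).2.
have /andP[t00 t0l] : 0 < t0 < len e0 by exact: (valP p).
pose m := Num.min t0 (len e0 - t0).
have m0 : 0 < m by rewrite lt_min t00 subr_gt0.
pose phi (y : geom G) := match y with
  | inl _ => m
  | inr q => if (val q).1 == e0 then Num.min `|(val q).2 - t0| m else m end.
have mt0 : m <= t0 by rewrite ge_min lexx.
have mlt0 : m <= len e0 - t0 by rewrite ge_min lexx orbT.
have phiE e s : 0 <= s <= len e ->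
    phi (epoint e s) = if e == e0 then Num.min `|s - t0| m else m.
  move=> /epointP[[-> ->]|[-> ->]|[q qE ->]] /=; last by rewrite qE.
  - case: ifP => // _; rewrite sub0r normrN gtr0_norm//.
    by apply/esym/min_idPr.
  - case: ifP => // /eqP ->; rewrite gtr0_norm ?subr_gt0//.
    by apply/esym/min_idPr.
have minlip (a b : R) : `|Num.min a m - Num.min b m| <= `|a - b|.
  rewrite ler_norml; move: (ler_norm (a - b)) (ler_norm (b - a)).
  rewrite (distrC b a) => h1 h2.
  by rewrite /Num.min; case: ifP => h3; case: ifP => h4; move: h3 h4;
    rewrite ?ltNge => /negP; rewrite ?negbK; move=> *; apply/andP; split; lra.
have lip : edge_lipschitz phi.
  move=> e s t hs ht; rewrite !phiE//; case: ifP => _; last by rewrite subrr normr0.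
  apply: le_trans (minlip _ _) _; apply: le_trans (ler_dist_dist _ _) _.
  by rewrite opprB addrA subrK.
have phip : phi (inr p) = 0.
  by rewrite /phi eqxx subrr normr0; apply/min_idPl/ltW.
have := edge_lipschitz_dist y (inr p) lip; rewrite phip d0 subr0.
case: y {d0} => [v /=|q]; first by rewrite leNgt m0.
rewrite /=; case: ifP => [/eqP qe|_ /(lt_le_trans m0)]; last by rewrite ltxx.
rewrite ge_min [m <= 0]leNgt m0 orbF normr_le0 subr_eq0 => /eqP qt.
by congr inr; apply/val_inj; rewrite [LHS]surjective_pairing qe qt
  -surjective_pairing.
Qed.

Let vertex_sep (u v : vertex G) :
  geodesic_dist (inl u) (inl v) = 0 -> u = v.
Proof.
move=> d0; pose m := \big[Num.min/1%R]_(e : edge G) len e.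
have m0 : 0 < m.
  by apply: lt_bigmin => // e _; exact: len_gt0.
have mlen e : m <= len e by exact: bigmin_le_cond.
pose c (w : vertex G) : R := if w == u then m else 0.
pose phi (y : geom G) := match y with
  | inl w => c w
  | inr q => let e := (val q).1 in
    c (src e) + (c (tgt e) - c (src e)) * ((val q).2 / len e) end.
have phiE e s : 0 <= s <= len e ->
    phi (epoint e s) = c (src e) + (c (tgt e) - c (src e)) * (s / len e).
  move=> /epointP[[-> ->]|[-> ->]|[q qE ->]] /=; last by rewrite qE.
  - by rewrite mul0r mulr0 addr0.
  - by rewrite divff ?gt_eqF ?len_gt0// mulr1 addrC subrK.
have lip : edge_lipschitz phi.
  move=> e s t hs ht; rewrite !phiE// opprD addrACA subrr add0r -mulrBr -mulrBl.
  rewrite normrM normrM mulrCA ler_piMr// normfV ler_pdivrMr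
    ?normr_gt0 ?gt_eqF ?len_gt0//.
  rewrite mul1r (gtr0_norm (len_gt0 e)); apply: le_trans (mlen e).
  by rewrite /c; case: ifP; case: ifP; rewrite ?subrr ?subr0 ?sub0r ?normrN
    ?normr0 ?(gtr0_norm m0)// ltW.
have := edge_lipschitz_dist (inl u) (inl v) lip; rewrite d0 /= /c eqxx.
case: eqP => [->//|_]; by rewrite subr0 leNgt m0.
Qed.

Lemma geodesic_dist_eq0 x y : geodesic_dist x y = 0 -> x = y.
Proof.
case: y => [v|p]; last exact: interior_sep.
case: x => [u /vertex_sep -> //|p].
by rewrite geodesic_dist_sym => /interior_sep.
Qed.

End GeomMetric.

(* This also gives |G| the metric topology. *)
HB.instance Definition _ (R : realType) (G : metric_graph R) :=
  isMetric.Build R (geom G) (@geodesic_distxx R G) (@geodesic_dist_eq0 R G)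
    (@geodesic_dist_sym R G) (@geodesic_dist_triangle R G).

Definition dist_from (R : realType) (G : metric_graph R) (v : geom G) :
  geom G -> R := fun x => mdist v x.

(* The quotient V / S of a module by a submodule: [Quotient.quot] is only an
   additive group, and a [submodClosed] is not a [zmodClosed]. *)
Section QuotientModule.
Context {K : fieldType} {V : lmodType K} (S : submodClosed V).
Local Open Scope quotient_scope.

Definition submod_mem : V -> bool := fun x => x \in S.

Let submod_mem_zmod : zmod_closed submod_mem.
Proof.
split=> [|x y xS yS]; rewrite unfold_in; first exact: rpred0.
by rewrite /submod_mem -scaleN1r rpredD// rpredZ.
Qed.

HB.instance Definition _ := GRing.isZmodClosed.Build V submod_mem
  submod_mem_zmod.

Let submod_mem_closed : zmodClosed V := GRing.ZmodClosed.clone V submod_mem _.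

Definition quotmod : Type := Quotient.quot submod_mem_closed.

HB.instance Definition _ := GRing.Zmodule.copy quotmod
  (Quotient.quot submod_mem_closed).

Definition quot_pi (x : V) : quotmod := \pi_(Quotient.quot submod_mem_closed) x.

Definition quot_repr (x : quotmod) : V :=
  repr (x : Quotient.quot submod_mem_closed).

Lemma quot_reprK : cancel quot_repr quot_pi.
Proof. exact: reprK. Qed.

Lemma quot_piE x y : (quot_pi x == quot_pi y) = (x - y \in S).
Proof. by rewrite /quot_pi -Quotient.idealrBE. Qed.

Let quot_piD : {morph quot_pi : x y / x + y}.
Proof. exact: raddfD. Qed.

Definition scaleq (k : K) (x : quotmod) : quotmod := quot_pi (k *: quot_repr x).

Let scaleq_pi k x : scaleq k (quot_pi x) = quot_pi (k *: x).
Proof.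
apply/eqP; rewrite quot_piE -scalerBr rpredZ//.
by rewrite -quot_piE quot_reprK.
Qed.

Let scaleqA a b x : scaleq a (scaleq b x) = scaleq (a * b) x.
Proof. by rewrite -[x]quot_reprK !scaleq_pi scalerA. Qed.
Let scale1q x : scaleq 1 x = x.
Proof. by rewrite -[x]quot_reprK scaleq_pi scale1r. Qed.
Let scaleqDr a x y : scaleq a (x + y) = scaleq a x + scaleq a y.
Proof.
by rewrite -[x]quot_reprK -[y]quot_reprK -quot_piD !scaleq_pi -quot_piD scalerDr.
Qed.
Let scaleqDl x a b : scaleq (a + b) x = scaleq a x + scaleq b x.
Proof. by rewrite -[x]quot_reprK !scaleq_pi -quot_piD scalerDl. Qed.

HB.instance Definition _ := GRing.Zmodule_isLmodule.Build K quotmod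
  scaleqA scale1q scaleqDr scaleqDl.

Let quot_pi_linear : linear quot_pi.
Proof. by move=> k x y; rewrite quot_piD -scaleq_pi. Qed.

HB.instance Definition _ :=
  GRing.isLinear.Build K V quotmod *:%R quot_pi quot_pi_linear.

End QuotientModule.

Section FreeModule.
Context {K : fieldType}.

Definition flin (T : choiceType) (V : lmodType K) (f : T -> V) :
  {freeg T / K} -> V := @fglift K V T f.

Context {T : choiceType}.
Section Flin.
Context {V : lmodType K} (f : T -> V).

Lemma flinU x : flin f << x >> = f x.
Proof. by rewrite /flin liftU scale1r. Qed.

Let flinB : {morph flin f : x y / x - y}.
Proof. exact: (lift_is_additive f). Qed.

HB.instance Definition _ := GRing.isZmodMorphism.Build _ _ (flin f) flinB.

Let flin_scalable : scalable (flin f).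
Proof.
move=> k D; rewrite -[D in RHS]freeg_sumE [k *: D]/(fgscale k D) /fgscale.
rewrite !raddf_sum /=; apply: eq_bigr => x _.
by rewrite /flin !liftU scalerA.
Qed.

HB.instance Definition _ := GRing.isScalable.Build K _ _ *:%R (flin f)
  flin_scalable.
End Flin.

Lemma flin_ext (V : lmodType K) (f g : {linear {freeg T / K} -> V}) :
  (forall x, f << x >> = g << x >>) -> f =1 g.
Proof.
move=> fg D; rewrite -[D]freeg_sumE !raddf_sum /=; apply: eq_bigr => x _.
suff -> : << coeff x D *g x >> = coeff x D *: << x >> :> {freeg T / K}.
  by rewrite !linearZ /= fg.
by apply/eqP/freeg_eqP => y; rewrite coeffZ !coeffU mul1r.
Qed.
End FreeModule.

Section Simplex.
Context (R : realType).

Definition stdsimplex (n : nat) : set 'rV[R]_n.+1 :=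
  [set x | (forall j, 0 <= x ord0 j) /\ \sum_j x ord0 j = 1].
Arguments stdsimplex : clear implicits.

(* The i-th face inclusion R^(n+1) -> R^(n+2) inserts a zero at position i. *)
Definition face_mx n (i : 'I_n.+2) (x : 'rV[R]_n.+1) : 'rV[R]_n.+2 :=
  \row_j (if unlift i j is Some k then x ord0 k else 0).

Lemma face_mx_simplex n (i : 'I_n.+2) x :
  stdsimplex n x -> stdsimplex n.+1 (face_mx i x).
Proof.
move=> [x0 x1]; split=> [j|]; first by rewrite mxE; case: unliftP.
rewrite (bigD1_ord i)//= mxE unlift_none add0r -x1.
by apply: eq_bigr => j _; rewrite mxE liftK.
Qed.

Definition face n (i : 'I_n.+2) (x : stdsimplex n) : stdsimplex n.+1 :=
  exist _ (face_mx i (set_val x))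
    (mem_set (face_mx_simplex i (set_mem (valP x)))).

Lemma face_continuous n (i : 'I_n.+2) : continuous (face i).
Proof.
have mxc : continuous (@face_mx n i).
  move=> x; have xF : Filter (nbhs x) by exact: nbhs_filter.
  apply/cvg_ballP => e e0.
  have : nbhs x (ball x e) by exact: nbhsx_ballx.
  apply: filterS => y [_ xy]; split=> // j k; rewrite !mxE; case: unliftP => [l _|_];
    last exact: ballxx.
  exact: xy.
apply: (@continuous_comp_initial _ _ _ set_val) => x.
exact: (continuous_comp (@initial_continuous _ _ _ _) (mxc _)).
Qed.

Section Chains.
Context (K : fieldType).

Definition singular n (X : topologicalType) : Type :=
  {s : stdsimplex n -> X | `[< continuous s >]}.

HB.instance Definition _ n (X : topologicalType) :=
  Choice.copy (singular n X) {s : stdsimplex n -> X | `[< continuous s >]}.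

Lemma singular_face_proof n (X : topologicalType) (i : 'I_n.+2)
  (s : singular n.+1 X) : `[< continuous (sval s \o face i) >].
Proof.
apply/asboolP => x; apply: continuous_comp; first exact: face_continuous.
exact: (asboolW (svalP s)).
Qed.

Definition singular_face n X i s : singular n X :=
  exist _ (sval s \o face i) (@singular_face_proof n X i s).

Lemma singular_comp_proof n (X Y : topologicalType) (f : X -> Y)
  (fc : continuous f) (s : singular n X) : `[< continuous (f \o sval s) >].
Proof.
apply/asboolP => x; apply: continuous_comp; last exact: fc.
exact: (asboolW (svalP s)).
Qed.

Definition singular_comp n X Y f fc s : singular n Y :=
  exist _ (f \o sval s) (@singular_comp_proof n X Y f fc s).

Definition chain n (X : topologicalType) : lmodType K :=
  {freeg (singular n X) / K}.

Definition boundary n (X : topologicalType) : {linear chain n.+1 X -> chain n X} :=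
  flin (fun s => \sum_(i < n.+2) (-1) ^+ i *: << singular_face i s >>).

Definition chain_map n (X Y : topologicalType) (f : X -> Y)
    (fc : continuous f) : {linear chain n X -> chain n Y} :=
  flin (fun s => << singular_comp fc s >>).

Lemma boundary_chain_map n (X Y : topologicalType) (f : X -> Y)
    (fc : continuous f) (c : chain n.+1 X) :
  boundary n Y (chain_map _ fc c) = chain_map _ fc (boundary n X c).
Proof.
apply: (flin_ext (f := boundary n Y \o chain_map _ fc)
                 (g := chain_map _ fc \o boundary n X)) => s /=.
rewrite !flinU linear_sum; apply: eq_bigr => i _.
rewrite linearZ /= flinU; congr (_ *: << _ >>).
by apply/val_inj.
Qed.

Definition is_cycle n (X : topologicalType) : chain n X -> bool :=
  match n return chain n X -> bool with
  | 0 => xpredT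
  | m.+1 => fun c => boundary m X c == 0
  end.

Let is_cycle_submod n X : subsemimod_closed (@is_cycle n X).
Proof.
case: n => [//|n]; split; first split.
- by rewrite unfold_in /= linear0.
- move=> c c'; rewrite !unfold_in /= => /eqP c0 /eqP c'0.
  by rewrite linearD /= c0 c'0 addr0.
- by move=> k c; rewrite !unfold_in /= => /eqP c0; rewrite linearZ /= c0 scaler0.
Qed.

HB.instance Definition _ n X := GRing.isSubmodClosed.Build K (chain n X)
  (@is_cycle n X) (@is_cycle_submod n X).

Definition cycles n (X : topologicalType) : Type := {c : chain n X | is_cycle c}.

HB.instance Definition _ n X := SubChoice.copy (cycles n X)
  {c : chain n X | is_cycle c}.
HB.instance Definition _ n X :=
  [SubChoice_isSubLmodule of cycles n X by <:].

Definition is_boundary n (X : topologicalType) : cycles n X -> bool :=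
  fun z => `[< exists c, boundary n X c = val z >].

Let is_boundary_submod n X : subsemimod_closed (@is_boundary n X).
Proof.
split; first split.
- by apply/asboolP; exists 0; rewrite !linear0.
- move=> z z' /asboolP[c cz] /asboolP[c' cz']; apply/asboolP.
  by exists (c + c'); rewrite !linearD /= cz cz'.
- move=> k z /asboolP[c cz]; apply/asboolP.
  by exists (k *: c); rewrite !linearZ /= cz.
Qed.

HB.instance Definition _ n X := GRing.isSubmodClosed.Build K (cycles n X)
  (@is_boundary n X) (@is_boundary_submod n X).

Definition boundaries n (X : topologicalType) : submodClosed (cycles n X) :=
  GRing.SubmodClosed.clone K (cycles n X) (@is_boundary n X) _.

Definition homology n (X : topologicalType) : lmodType K :=
  quotmod (boundaries n X).

Section Functor.
Context (n : nat) {X Y : topologicalType} (f : X -> Y) (fc : continuous f).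

Lemma chain_map_cycle (z : cycles n X) : is_cycle (chain_map n fc (val z)).
Proof.
case: n z => [//|m] [c c0]; apply/eqP.
have c0' : boundary m X c = 0 by exact/eqP.
by rewrite boundary_chain_map c0' linear0.
Qed.

Definition cycle_map (z : cycles n X) : cycles n Y :=
  exist _ (chain_map n fc (val z)) (chain_map_cycle z).

Let cycle_map_linear : linear cycle_map.
Proof. by move=> k z z'; apply/val_inj; rewrite /= !linearP. Qed.

HB.instance Definition _ := GRing.isLinear.Build K _ _ *:%R cycle_map
  cycle_map_linear.

Definition homology_map_fun (h : homology n X) : homology n Y :=
  quot_pi _ (cycle_map (quot_repr h)).

Lemma homology_map_pi (z : cycles n X) :
  homology_map_fun (quot_pi _ z) = quot_pi _ (cycle_map z).
Proof.
apply/eqP; rewrite quot_piE -linearB.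
have : quot_repr (quot_pi _ z : homology n X) - z \in boundaries n X.
  by rewrite -quot_piE quot_reprK.
move=> /asboolP[c cz]; apply/asboolP; exists (chain_map _ fc c).
by rewrite boundary_chain_map cz.
Qed.

Let homology_map_linear : linear homology_map_fun.
Proof.
move=> k x y; rewrite -[x]quot_reprK -[y]quot_reprK -linearP.
by rewrite !homology_map_pi !linearP.
Qed.

HB.instance Definition _ := GRing.isLinear.Build K _ _ *:%R homology_map_fun
  homology_map_linear.

Definition homology_map : {linear homology n X -> homology n Y} :=
  homology_map_fun.

End Functor.
End Chains.
End Simplex.

Section Zigzag.
Context (K : fieldType) (n : nat).

(* M_0 -> M_1 <- M_2 -> ... <- M_(2n).  The modules [zobj k] with 2n < k are
   irrelevant. *)
Record zigzag := Zigzag {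
  zobj : nat -> lmodType K;
  zfwd : forall i, (i < n)%N -> {linear zobj i.*2 -> zobj i.*2.+1};
  zbwd : forall i, (i < n)%N -> {linear zobj i.*2.+2 -> zobj i.*2.+1}
}.

Definition zigzag_iso (M N : zigzag) : Prop :=
  exists phi : forall k, {linear zobj M k -> zobj N k},
    [/\ forall k, (k <= n.*2)%N -> bijective (phi k),
        forall i (lt_in : (i < n)%N) x,
          phi _ (zfwd M lt_in x) = zfwd N lt_in (phi _ x) &
        forall i (lt_in : (i < n)%N) x,
          phi _ (zbwd M lt_in x) = zbwd N lt_in (phi _ x)].

(* K at the positions p <= k <= q, where the row vectors have length 1, and 0
   elsewhere, where they have length 0.  Multiplication by the all-ones matrix
   is the identity of K between two positions of the interval. *)
Definition interval_module (p q : nat) : zigzag := {|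
  zobj k := 'rV[K]_(p <= k <= q)%N;
  zfwd i _ := mulmxr (const_mx 1);
  zbwd i _ := mulmxr (const_mx 1)
|}.

Definition zigzag_zero : zigzag := {|
  zobj _ := 'rV[K]_0;
  zfwd _ _ := idfun;
  zbwd _ _ := idfun
|}.

Definition prod_map (U U' V V' : lmodType K) (f : U -> U') (g : V -> V')
  (x : U * V) : U' * V' := (f x.1, g x.2).

Lemma prod_map_linear (U U' V V' : lmodType K) (f : {linear U -> U'})
  (g : {linear V -> V'}) : linear (prod_map f g).
Proof. by move=> k x y; rewrite /prod_map /= !linearP. Qed.

HB.instance Definition _ (U U' V V' : lmodType K) (f : {linear U -> U'})
  (g : {linear V -> V'}) :=
  GRing.isLinear.Build K (U * V)%type (U' * V')%type *:%R (prod_map f g)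
    (prod_map_linear f g).

Definition zigzag_dsum (M N : zigzag) : zigzag := {|
  zobj k := (zobj M k * zobj N k)%type;
  zfwd i lt_in := prod_map (zfwd M lt_in) (zfwd N lt_in);
  zbwd i lt_in := prod_map (zbwd M lt_in) (zbwd N lt_in)
|}.

(* [B] is a list, up to order, of the first and last nonzero positions of the
   interval modules in a decomposition of [M]. *)
Definition interval_decomposition (M : zigzag) (B : seq (nat * nat)) : Prop :=
  all (fun I => (I.1 <= I.2 <= n.*2)%N) B /\
  zigzag_iso M (foldr (fun I => zigzag_dsum (interval_module I.1 I.2))
                      zigzag_zero B).

End Zigzag.

Definition locally_connected (Z : topologicalType) : Prop :=
  forall (z : Z) (U : set Z), nbhs z U ->
    exists V : set Z, [/\ open V, V z, connected V & V `<=` U].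

Definition finitely_generated (K : fieldType) (V : lmodType K) : Prop :=
  exists (m : nat) (e : 'I_m -> V), forall x : V,
    exists c : 'I_m -> K, x = \sum_i c i *: e i.

Definition set_incl (T : Type) (A B : set T) (AB : A `<=` B) (x : A) : B :=
  exist _ (set_val x) (mem_set (AB _ (set_mem (valP x)))).

Lemma set_incl_continuous (T : topologicalType) (A B : set T) (AB : A `<=` B) :
  continuous (set_incl AB).
Proof.
apply: (@continuous_comp_initial _ _ _ set_val).
exact: (@initial_continuous _ _ set_val).
Qed.

Section LevelSetZigzag.
Context {R : realType} (K : fieldType) {T : topologicalType} (f : T -> R).
Context (n : nat) (a s : nat -> R).

(* The critical values are a_1 < ... < a_n; the other values of the sequence
   [a] are irrelevant, and a_0 = -oo, a_(n+1) = +oo. *)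
Definition crit (i : nat) : \bar R :=
  if i == 0%N then -oo%E else if (i <= n)%N then (a i)%:E else +oo%E.

Definition gap (i : nat) : set R :=
  [set t | (crit i < t%:E)%E && (t%:E < crit i.+1)%E].

(* [h] is a homeomorphism over J with inverse [g], and [hbar] extends it. *)
Definition trivial_over (J : set R) : Prop :=
  exists Z : topologicalType,
    [/\ compact [set: Z], locally_connected Z &
      exists (h : (Z * J)%type -> (f @^-1` J))
             (g : (f @^-1` J) -> (Z * J)%type)
             (hbar : (Z * closure J)%type -> T),
        [/\ continuous h /\ continuous g,
            cancel h g /\ cancel g h,
            forall z, f (set_val (h z)) = set_val z.2,
            continuous hbar &
            forall z t, hbar (z, set_incl (@subset_closure _ J) t)
                        = set_val (h (z, t))]].

Definition morse_type : Prop :=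
  [/\ forall i j, (0 < i)%N -> (i < j)%N -> (j <= n)%N -> a i < a j,
      forall i, (i <= n)%N -> trivial_over (gap i) &
      forall (c : R) (p : nat),
        finitely_generated (homology R K p (f @^-1` [set c]))].

Definition interleaved : Prop :=
  forall i, (i < n)%N -> s i < a i.+1 < s i.+1.

(* The space at position k: X_(s_i)^(s_i) for k = 2i and X_(s_i)^(s_(i+1)) for
   k = 2i+1. *)
Definition slab (k : nat) : set T := f @^-1` `[s k./2, s (uphalf k)].

Lemma slab_fwd (hs : interleaved) i : (i < n)%N -> slab i.*2 `<=` slab i.*2.+1.
Proof.
move=> /hs/andP[sa as' x]; rewrite /slab /= uphalf_double doubleK !in_itv /=.
move=> /andP[-> /le_trans]; apply.
by rewrite ltW// (lt_trans sa).
Qed.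

Lemma slab_bwd (hs : interleaved) i :
  (i < n)%N -> slab i.*2.+2 `<=` slab i.*2.+1.
Proof.
move=> /hs/andP[sa as' x]; rewrite /slab /= uphalf_double doubleK !in_itv /=.
move=> /andP[sx ->]; rewrite andbT; apply: le_trans sx.
by rewrite ltW// (lt_trans sa).
Qed.

Definition lzz (hs : interleaved) : zigzag K n := {|
  zobj k := homology R K 0%N (slab k);
  zfwd i lt_in :=
    @homology_map R K 0%N _ _ _
      (@set_incl_continuous _ _ _ (slab_fwd hs lt_in));
  zbwd i lt_in :=
    @homology_map R K 0%N _ _ _
      (@set_incl_continuous _ _ _ (slab_bwd hs lt_in))
|}.

End LevelSetZigzag.

(* A multiset of points of dimension 0 or 1, as an indexed family: an element of
   multiplicity m is the value of [ppoint] at m indices.  [pdim] is true iff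
   the dimension is 1. *)
Record diagram (R : realType) := Diagram {
  pidx : Type;
  pdim : pidx -> bool;
  ppoint : pidx -> \bar R * \bar R
}.

Section Diagrams.
Context {R : realType}.
Implicit Types D : diagram R.

(* |x - y|, with value 0 when x and y are the same infinity. *)
Definition coord_dist (x y : \bar R) : \bar R :=
  if x == y then 0%E else `|x - y|%E.

Definition linf_dist (x y : \bar R * \bar R) : \bar R :=
  maxe (coord_dist x.1 y.1) (coord_dist x.2 y.2).

Definition matching_cost D D' (mu : pidx D -> pidx D') : \bar R :=
  ereal_sup [set linf_dist (ppoint x) (ppoint (mu x)) | x in [set: pidx D]].

Definition bottleneck D D' : \bar R :=
  ereal_inf [set matching_cost mu | mu in
    [set mu : pidx D -> pidx D' |
      bijective mu /\ forall x, pdim (mu x) = pdim x]].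

(* The last branch is only reached when d < b. *)
Definition restrict_point (r1 r2 : R) (x : \bar R * \bar R) : \bar R * \bar R :=
  let: (b, d) := x in
  (if [&& r1%:E <= b, b <= d & d <= r2%:E] then (b, d)
   else if [&& r1%:E <= b, b <= r2%:E & r2%:E <= d] then (b, r2%:E)
   else if [&& b <= r1%:E, r1%:E <= d & d <= r2%:E] then (r1%:E, d)
   else if [&& b <= r1%:E, r1%:E <= r2%:E & r2%:E <= d] then (r1%:E, r2%:E)
   else if r2%:E <= b then (b, b)
   else if d <= r1%:E then (d, d)
   else (b, d))%E.

Definition restrict_diagram (r1 r2 : R) D : diagram R := {|
  pdim := @pdim R D;
  ppoint x := restrict_point r1 r2 (ppoint x)
|}.

(* The endpoints of an interval of positions p <= k <= q of the level set
   zigzag; position 2i is X_(s_i)^(s_i), position 2i-1 is X_(s_(i-1))^(s_i).  It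
   is left-closed iff p is odd. *)
Definition interval_point (n : nat) (a : nat -> R) (I : nat * nat) :
  \bar R * \bar R := (crit n a (uphalf I.1), crit n a (I.2)./2.+1).

Definition interval_dim (I : nat * nat) : bool := ~~ odd I.1.

(* The points of the intervals in [B], together with, for each dimension,
   countably many copies (x, x), indexed by nat, of every diagonal point. *)
Definition barcode_diagram (n : nat) (a : nat -> R) (B : seq (nat * nat)) :
    diagram R := {|
  pidx := ('I_(size B) + bool * R * nat)%type;
  pdim i := match i with
            | inl j => interval_dim (nth (0%N, 0%N) B j)
            | inr (dim, _, _) => dim
            end;
  ppoint i := match i with
              | inl j => interval_point n a (nth (0%N, 0%N) B j)
              | inr (_, x, _) => (x%:E, x%:E)
              end
|}.

(* [D] is the level set zigzag persistence diagram of [f], as an indexed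
   family, so up to the order of the intervals. *)
Definition is_lzz_diagram (K : fieldType) (T : topologicalType) (f : T -> R) D :
    Prop :=
  exists (n : nat) (a s : nat -> R) (hs : interleaved n a s)
         (B : seq (nat * nat)),
    [/\ morse_type K f n a,
        interval_decomposition (lzz K f hs) B &
        D = barcode_diagram n a B].

(* Sets of diagrams are plain predicates: [diagram R] is too large a type for
   [set]. *)
Definition diagram_hausdorff (S1 S2 : diagram R -> Prop) : \bar R :=
  maxe
    (ereal_sup [set x | exists2 D1, S1 D1 &
       x = ereal_inf [set y | exists2 D2, S2 D2 & y = bottleneck D1 D2]])
    (ereal_sup [set x | exists2 D2, S2 D2 &
       x = ereal_inf [set y | exists2 D1, S1 D1 & y = bottleneck D1 D2]]).

Definition distance_diagrams (K : fieldType) (G : metric_graph R)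
  (D : diagram R) : Prop :=
  exists v : geom G, is_lzz_diagram K (dist_from v) D.

Definition local_distance_diagrams (K : fieldType) (r : R) (G : metric_graph R)
  (D : diagram R) : Prop :=
  exists2 D0, distance_diagrams K G D0 & D = restrict_diagram 0 r D0.

Definition local_persistence_distortion (K : fieldType) (r : R)
    (G1 G2 : metric_graph R) : \bar R :=
  diagram_hausdorff (local_distance_diagrams K r G1)
                    (local_distance_diagrams K r G2).

End Diagrams.

(* Main.v *)
Require Import Defs.
From mathcomp Require Import all_boot all_order all_algebra.
From mathcomp Require Import all_classical all_reals all_analysis.

(** Restricting a diagram to an interval I is, on points (b, d) with b <= d,
the map Pi_I (b, d) = (min d (max b r1), max b (min d r2)).  This closed form
makes two facts evident.  Each coordinate is a composite of minima and maxima,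
so Pi_I is 1-Lipschitz for the l-infinity distance ([linf_dist_restrict_le]);
and distributivity of minima over maxima gives Pi_I (Pi_I' x) = Pi_I x whenever
I is contained in I' ([restrict_point_restrict]).

Hence, for I contained in I', Pi_I maps the restriction to I' of any diagram to
its restriction to I without moving any two points apart.  A restriction has
the same index set as the original diagram, so the very same matchings are
available for both intervals, and each costs at most as much for I as for I'
([bottleneck_restrict_le]).  Since the two families of local diagrams are
indexed by the same base points, both halves of the Hausdorff distance inherit
the inequality ([directed_hausdorff_le]).

Points of level set zigzag diagrams do satisfy b <= d
([distance_diagrams_above]), because the critical values of a function of Morse
type increase along the zigzag. *)

Import Order.TTheory GRing.Theory Num.Theory.

Local Open Scope classical_set_scope.
Local Open Scope ring_scope.

(** * Distances between extended reals under minima and maxima *)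

Section CoordDist.
Context {R : realType}.
Implicit Types (x y z t : \bar R) (e : R).
Local Open Scope ereal_scope.

Lemma coord_dist_ge0 x y : 0 <= coord_dist x y.
Proof. by rewrite /coord_dist; case: ifP. Qed.

(** Unlike the subtraction that defines the distance, these one-sided bounds are
preserved by every monotone operation that commutes with translations.  The
bound has to be finite: as -oo + +oo = -oo, the equivalence fails for +oo. *)
Lemma coord_dist_leP x y e : (0 <= e)%R ->
  coord_dist x y <= e%:E <-> x <= y + e%:E /\ y <= x + e%:E.
Proof.
move=> e0; rewrite /coord_dist; case: eqP => [<-|xy].
  by rewrite lee_fin e0 leeDl ?lee_fin.
case: x xy => [x||]; case: y => [y||] //= xy;
  try by split=> // -[].
by rewrite -!EFinD !lee_fin ler_distlC lerBlDr; split=> [/andP[]|[-> ->]].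
Qed.

Lemma coord_dist_op_le (op : \bar R -> \bar R -> \bar R) x x' y y' m :
  (forall x y z t, x <= z -> y <= t -> op x y <= op z t) ->
  (forall x y z, op x y + z = op (x + z) (y + z)) ->
  coord_dist x x' <= m -> coord_dist y y' <= m ->
  coord_dist (op x y) (op x' y') <= m.
Proof.
move=> op_le opD; case: m => [e||] dx dy.
- have e0 : (0 <= e)%R.
    by rewrite -lee_fin (le_trans (coord_dist_ge0 _ _) dx).
  case/(coord_dist_leP _ _ _ e0): dx => dx dx'.
  case/(coord_dist_leP _ _ _ e0): dy => dy dy'.
  by apply/(coord_dist_leP _ _ _ e0); rewrite !opD; split; exact: op_le.
- exact: leey.
- by have := le_trans (coord_dist_ge0 _ _) dx.
Qed.

Lemma coord_dist_max_le x x' y y' m :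
  coord_dist x x' <= m -> coord_dist y y' <= m ->
  coord_dist (maxe x y) (maxe x' y') <= m.
Proof.
by apply: coord_dist_op_le => *; [exact: le_max2 | exact: adde_maxl].
Qed.

Lemma coord_dist_min_le x x' y y' m :
  coord_dist x x' <= m -> coord_dist y y' <= m ->
  coord_dist (mine x y) (mine x' y') <= m.
Proof.
apply: coord_dist_op_le => [*|{}x {}y z]; first exact: le_min2.
by have [xy|/ltW yx] := leP x y; [rewrite min_l | rewrite min_r]; rewrite ?leeD2r.
Qed.

End CoordDist.

(** * Restriction of points *)

Section RestrictPoint.
Context {R : realType}.
Implicit Types (b d : \bar R) (r : R) (p q : \bar R * \bar R).
Local Open Scope ereal_scope.

(** The defining case distinction read off as clipping: b is raised to r1 and d
lowered to r2, unless this would carry one coordinate past the other. *)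
Lemma restrict_pointE r1 r2 b d : (r1 <= r2)%R -> b <= d ->
  restrict_point r1 r2 (b, d) =
    (mine d (maxe b r1%:E), maxe b (mine d r2%:E)).
Proof.
rewrite -lee_fin => r12 bd; rewrite /restrict_point.
case: ifP => [/and3P[r1b _ dr2]|nA].
  by rewrite (max_l r1b) (min_r bd) (min_l dr2) (max_r bd).
case: ifP => [/and3P[r1b br2 r2d]|nB].
  by rewrite (max_l r1b) (min_r bd) (min_r r2d) (max_r br2).
case: ifP => [/and3P[br1 r1d dr2]|nC].
  by rewrite (max_r br1) (min_r r1d) (min_l dr2) (max_r bd).
case: ifP => [/and3P[br1 _ r2d]|nD].
  rewrite (max_r br1) (min_r (le_trans r12 r2d)) (min_r r2d).
  by rewrite (max_r (le_trans br1 r12)).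
case: ifP => [r2b|/negbT]; last rewrite -ltNge => br2.
  rewrite (max_l (le_trans r12 r2b)) (min_r bd) (min_r (le_trans r2b bd)).
  by rewrite (max_l r2b).
case: ifP => [dr1|/negbT]; last rewrite -ltNge => r1d.
  rewrite (max_r (le_trans bd dr1)) (min_l dr1) (min_l (le_trans dr1 r12)).
  by rewrite (max_r bd).
move: nA nB nC nD; rewrite bd r12 (ltW br2) (ltW r1d) /=.
by case: (leP r1%:E b) => [_|/ltW ->]; case: (leP d r2%:E) => // /ltW ->.
Qed.

Lemma restrict_point_above r1 r2 p : (r1 <= r2)%R -> p.1 <= p.2 ->
  (restrict_point r1 r2 p).1 <= (restrict_point r1 r2 p).2.
Proof.
case: p => b d r12 bd; rewrite restrict_pointE//=.
rewrite -[d in mine d (maxe _ _)](max_r bd) -max_minr.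
by apply: le_max2 => //; apply: le_min2 => //; rewrite lee_fin.
Qed.

Lemma restrict_point_restrict r1 r2 r1' r2' p :
  (r1' <= r1)%R -> (r1 <= r2)%R -> (r2 <= r2')%R -> p.1 <= p.2 ->
  restrict_point r1 r2 (restrict_point r1' r2' p) = restrict_point r1 r2 p.
Proof.
case: p => b d r1'1 r12 r22' bd.
have r1'2' : (r1' <= r2')%R by exact: le_trans (le_trans r12 r22').
have := restrict_point_above r1' r2' (b, d) r1'2' bd.
rewrite (restrict_pointE r1' r2')// => bd'.
rewrite !restrict_pointE//; congr pair.
(* As b <= d, the first coordinate of Pi_I' (b, d) may be replaced by b in the
   maximum with r1; dually for the second coordinate and r2. *)
- have -> : maxe (mine d (maxe b r1'%:E)) r1%:E = maxe b r1%:E.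
    rewrite max_minl -maxA (max_r (x := r1'%:E)) ?lee_fin//.
    by rewrite -max_minl (min_r bd).
  rewrite -max_minr -minA (min_r (x := r2'%:E)) ?lee_fin ?(le_trans r12)//.
  by rewrite max_minr (max_r bd).
- have -> : mine (maxe b (mine d r2'%:E)) r2%:E = mine d r2%:E.
    rewrite min_maxl -minA (min_r (x := r2'%:E)) ?lee_fin//.
    by rewrite -min_maxl (max_r bd).
  rewrite -min_maxr -maxA (max_r (x := r1'%:E)) ?lee_fin ?(le_trans r1'1)//.
  by rewrite min_maxr (min_r bd).
Qed.

(** The constants r1 and r2 are at distance 0 from themselves, so each coordinate
of the closed form moves at most as far as b or d does. *)
Lemma linf_dist_restrict_le r1 r2 p q :
  (r1 <= r2)%R -> p.1 <= p.2 -> q.1 <= q.2 ->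
  linf_dist (restrict_point r1 r2 p) (restrict_point r1 r2 q) <= linf_dist p q.
Proof.
case: p q => [b d] [b' d'] r12 bd bd'; rewrite !restrict_pointE//.
have cst r : coord_dist r%:E r%:E <= linf_dist (b, d) (b', d').
  by rewrite {1}/coord_dist eqxx /linf_dist le_max coord_dist_ge0.
have lb : coord_dist b b' <= linf_dist (b, d) (b', d').
  by rewrite /linf_dist le_max lexx.
have ld : coord_dist d d' <= linf_dist (b, d) (b', d').
  by rewrite /linf_dist le_max lexx orbT.
rewrite {1}/linf_dist ge_max/=; apply/andP; split.
  by apply: coord_dist_min_le => //; exact: coord_dist_max_le.
by apply: coord_dist_max_le => //; exact: coord_dist_min_le.
Qed.

End RestrictPoint.

(** * Restriction of diagrams *)

Section RestrictDiagram.
Context {R : realType}.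
Local Open Scope ereal_scope.

Definition above_diagonal (D : diagram R) : Prop :=
  forall x : pidx D, (ppoint x).1 <= (ppoint x).2.

Lemma bottleneck_restrict_le r1 r2 r1' r2' (D1 D2 : diagram R) :
  (r1' <= r1)%R -> (r1 <= r2)%R -> (r2 <= r2')%R ->
  above_diagonal D1 -> above_diagonal D2 ->
  bottleneck (restrict_diagram r1 r2 D1) (restrict_diagram r1 r2 D2) <=
  bottleneck (restrict_diagram r1' r2' D1) (restrict_diagram r1' r2' D2).
Proof.
move=> r1'1 r12 r22' up1 up2.
have r1'2' : (r1' <= r2')%R by exact: le_trans (le_trans r12 r22').
apply: le_ereal_inf_tmp => _ [mu mu_match <-].
apply: ge_ereal_inf; eexists; first by exists mu.
apply: ge_ereal_sup => _ [x _ <-] /=.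
apply: le_trans (ereal_sup_ubound _); last by exists x.
rewrite /= -(restrict_point_restrict r1 r2 r1' r2' (ppoint (x : pidx D1)))//.
rewrite -(restrict_point_restrict r1 r2 r1' r2' (ppoint (mu x : pidx D2)))//.
by apply: linf_dist_restrict_le => //; exact: restrict_point_above.
Qed.

End RestrictDiagram.

(** * Level set zigzag diagrams lie above the diagonal *)

Section AboveDiagonal.
Context {R : realType}.

Lemma crit_le n (a : nat -> R) i j :
  (forall i j, (0 < i)%N -> (i < j)%N -> (j <= n)%N -> a i < a j) ->
  (i <= j)%N -> (crit n a i <= crit n a j)%E.
Proof.
move=> incr_a; rewrite leq_eqVlt => /predU1P[->//|ij]; rewrite /crit.
case: (posnP i) => [_|i0]; first by rewrite leNye.
rewrite (gtn_eqF (leq_ltn_trans _ ij))//.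
case: (leqP j n) => [jn|_]; last by rewrite leey.
rewrite (leq_trans (ltnW ij) jn) lee_fin ltW//.
exact: incr_a.
Qed.

(** For I = (p, q) this reduces to ceil (p/2) <= floor (q/2) + 1.  Equality
occurs when p = q is odd: the point then lies on the diagonal and comes from a
feature present at a single critical value. *)
Lemma interval_point_above n (a : nat -> R) (I : nat * nat) :
  (forall i j, (0 < i)%N -> (i < j)%N -> (j <= n)%N -> a i < a j) ->
  (I.1 <= I.2)%N ->
  ((interval_point n a I).1 <= (interval_point n a I).2)%E.
Proof.
move=> incr_a I12; apply: crit_le => //.
rewrite uphalf_half -add1n; apply: leq_add; first by case: odd.
exact: half_leq.
Qed.

Lemma lzz_diagram_above (K : fieldType) (T : topologicalType) (f : T -> R) D :
  is_lzz_diagram K f D -> above_diagonal D.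
Proof.
case=> n [a [s [hs [B [[incr_a _ _] [Bpos _] ->]]]]] [j|[[dim x] m]] //=.
apply: interval_point_above => //.
by have /andP[] := allP Bpos _ (mem_nth (0%N, 0%N) (ltn_ord j)).
Qed.

Lemma distance_diagrams_above (K : fieldType) (G : metric_graph R) D :
  distance_diagrams K G D -> above_diagonal D.
Proof. by case=> v /lzz_diagram_above. Qed.

End AboveDiagonal.

(** * The local persistence distortion distance *)

(** Stated for an arbitrary cost c, so that it also applies to the other half of
the Hausdorff distance, where [bottleneck] occurs with its arguments
exchanged. *)
Lemma directed_hausdorff_le (R : realType) (T : Type) (S1 S2 : T -> Prop)
    (f g : T -> T) (c : T -> T -> \bar R) :
  (forall D1 D2, S1 D1 -> S2 D2 -> (c (f D1) (f D2) <= c (g D1) (g D2))%E) ->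
  (ereal_sup [set x | exists2 D1, (exists2 D, S1 D & D1 = f D) &
     x = ereal_inf [set y | exists2 D2, (exists2 D, S2 D & D2 = f D) &
       y = c D1 D2]]
   <= ereal_sup [set x | exists2 D1, (exists2 D, S1 D & D1 = g D) &
     x = ereal_inf [set y | exists2 D2, (exists2 D, S2 D & D2 = g D) &
       y = c D1 D2]])%E.
Proof.
move=> cfg; apply: ge_ereal_sup => _ [_ [D1 S1D1 ->] ->].
apply: le_ereal_sup_tmp; eexists; first by exists (g D1); [exists D1|].
apply: le_ereal_inf_tmp => _ [_ [D2 S2D2 ->] ->].
apply: ge_ereal_inf; exists (c (f D1) (f D2)); last exact: cfg.
by exists (f D2); [exists D2|].
Qed.

Theorem corollary6 (R : realType) (K : fieldType) (G1 G2 : metric_graph R)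
    (r r' : R) (hr : 0 <= r) (hrr' : r <= r') :
  (local_persistence_distortion K r G1 G2
     <= local_persistence_distortion K r' G1 G2)%E.
Proof.
have restrict_le G G' D1 D2 :
    distance_diagrams K G D1 -> distance_diagrams K G' D2 ->
    (bottleneck (restrict_diagram 0 r D1) (restrict_diagram 0 r D2)
     <= bottleneck (restrict_diagram 0 r' D1) (restrict_diagram 0 r' D2))%E.
  move=> /distance_diagrams_above up1 /distance_diagrams_above up2.
  exact: bottleneck_restrict_le.
apply: le_max2.
  by apply: directed_hausdorff_le => D1 D2; exact: restrict_le.
apply: (directed_hausdorff_le _ _ _ _ _ _ (fun D2 D1 => bottleneck D1 D2)).
by move=> D2 D1 S2D2 S1D1; exact: restrict_le S1D1 S2D2.
Qed.
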